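(* Let $V$ be a vertex operator superalgebra of central charge $c$, let $k$ be an even positive integer and $g=(1\;2\;\cdots\;k)$ acting on $V^{\otimes k}$, and let $(M_\sigma,Y_\sigma)$ be a weak $\sigma$-twisted (parity-twisted) $V$-module. Then $(M_\sigma,Y_\sigma)$ is an ordinary $\sigma$-twisted $V$-module with graded dimension $$\dim_qM_\sigma=\mathrm{tr}_{M_\sigma}q^{-c/24+L^\sigma(0)}=q^{-c/24}\sum_{\lambda\in\mathbb C}\dim(M_\lambda)q^\lambda$$ if and only if $(T_g^k(M_\sigma),Y_g)$ is an ordinary $g$-twisted $V^{\otimes k}$-module with graded dimension $$\dim_qT_g^k(M_\sigma)=\mathrm{tr}_{T_g^k(M_\sigma)}q^{-kc/24+L^g(0)}=\mathrm{tr}_{T_g^k(M_\sigma)}q^{-kc/24+\frac1kL^\sigma(0)+(k^2-1)c/24k}=\dim_{q^{1/k}}M_\sigma.$$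
   Context: Formal calculus: $\delta(x)=\sum_{n\in\mathbb Z}x^n$; $(x_1-x_2)^n$, $n\in\mathbb C$, is expanded in nonnegative integral powers of the second variable. Vertex (operator) superalgebras: A vertex superalgebra $(V,Y,\mathbf 1)$ is a $\mathbb Z_2$-graded space $V=V^{(0)}\oplus V^{(1)}$ ($|v|=j$ for $v\in V^{(j)}$) with a linear map $v\mapsto Y(v,x)=\sum_{n\in\mathbb Z}v_nx^{-n-1}$, $v_n\in(\mathrm{End}\,V)^{(|v|)}$, and $\mathbf 1\in V^{(0)}$ such that $u_nv=0$ for $n$ sufficiently large, $Y(\mathbf 1,x)=\mathrm{Id}_V$, $Y(v,x)\mathbf 1\in V[[x]]$ with $\lim_{x\to0}Y(v,x)\mathbf 1=v$, and for $u,v$ of homogeneous sign $x_0^{-1}\delta(\frac{x_1-x_2}{x_0})Y(u,x_1)Y(v,x_2)-(-1)^{|u||v|}x_0^{-1}\delta(\frac{x_2-x_1}{-x_0})Y(v,x_2)Y(u,x_1)=x_2^{-1}\delta(\frac{x_1-x_0}{x_2})Y(Y(u,x_0)v,x_2)$. A vertex operator superalgebra is a vertex superalgebra with $\omega\in V_2$, $Y(\omega,x)=\sum_nL(n)x^{-n-2}$, where the $L(n)$ satisfy the Virasoro relations with central charge $c\in\mathbb C$, $Y(L(-1)v,x)=\frac{d}{dx}Y(v,x)$, $V=\coprod_{n\in\frac12\mathbb Z}V_n$ with $L(0)=n=\mathrm{wt}$ on $V_n$, $\dim V_n<\infty$, $V_n=0$ for $n$ sufficiently negative, and $V^{(j)}=\coprod_{n\in\mathbb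 Z+j/2}V_n$. The parity map is the automorphism $\sigma(v)=(-1)^{|v|}v$. Twisted modules: Let $g$ be an automorphism of $V$ of period $k$ (so $g^k=1$) and $\eta$ a fixed primitive $k$-th root of unity. A weak $g$-twisted $V$-module is a $\mathbb Z_2$-graded space $M$ with a linear map $v\mapsto Y_g(v,x)=\sum_{n\in\frac1k\mathbb Z}v^g_nx^{-n-1}\in(\mathrm{End}\,M)[[x^{1/k},x^{-1/k}]]$, $v_n^g\in(\mathrm{End}\,M)^{(|v|)}$, such that $v^g_nw=0$ for $n$ sufficiently large, $Y_g(\mathbf 1,x)=\mathrm{Id}_M$, and for $u,v$ of homogeneous sign $x_0^{-1}\delta(\frac{x_1-x_2}{x_0})Y_g(u,x_1)Y_g(v,x_2)-(-1)^{|u||v|}x_0^{-1}\delta(\frac{x_2-x_1}{-x_0})Y_g(v,x_2)Y_g(u,x_1)=\frac{x_2^{-1}}{k}\sum_{j\in\mathbb Z/k\mathbb Z}\delta\big(\eta^j\frac{(x_1-x_0)^{1/k}}{x_2^{1/k}}\big)Y_g(Y(g^ju,x_0)v,x_2)$. A weak $\sigma$-twisted (parity-twisted) module is the case $g=\sigma$, of period 2. An ordinary $g$-twisted $V$-module is a weak $g$-twisted module $M=\coprod_{\lambda\in\mathbb C}M_\lambda$ with $M_\lambda$ the $\lambda$-eigenspace of the coefficient of $x^{-2}$ in $Y_g(\omega,x)$, $\dim M_\lambda<\infty$, and for fixed $\lambda$, $M_{n/2k+\lambda}=0$ for all sufficiently small integers $n$. $L^\sigma(0)$ is the coefficient of $x^{-2}$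 in $Y_\sigma(\omega,x)$ and $L^g(0)$ is the coefficient of $x^{-2}$ in $Y_g(\bar\omega,x)$, $\bar\omega=\sum_{j=1}^k\omega^j$; $M_\lambda$ in the claim is the $\lambda$-eigenspace of $L^\sigma(0)$ on $M_\sigma$, and $\dim_{q^{1/k}}M_\sigma$ is $\dim_qM_\sigma$ with $q$ replaced by $q^{1/k}$. Tensor products: $V^{\otimes k}$ is a vertex operator superalgebra (central charge $kc$) with $(Y\otimes Y')(u\otimes u',x)(v\otimes v')=(-1)^{|u'||v|}Y(u,x)v\otimes Y'(u',x)v'$ (iterated), vacuum $\mathbf 1^{\otimes k}$ and conformal vector $\bar\omega$, where for $v\in V$, $v^j\in V^{\otimes k}$ has $j$-th tensor factor $v$ and all others $\mathbf 1$. The automorphism $g=(1\;2\;\cdots\;k)$ acts by $g(v_1\otimes\cdots\otimes v_k)=(-1)^{|v_1|(|v_2|+\cdots+|v_k|)}v_2\otimes\cdots\otimes v_k\otimes v_1$. The $v^j$ generate $V^{\otimes k}$, so the operators $Y_g(v^j,x)$ determine $Y_g$ on all of $V^{\otimes k}$. $\eta$ denotes a fixed primitive $k$-th root of unity. The operator $\Delta_k$: define $a_j\in\mathbb C$, $j\ge1$, by $\exp\big(-\sum_{j\ge1}a_jx^{j+1}\frac{\partial}{\partial x}\big)\cdot x=\frac1k(1+x)^k-\frac1k$, and $\Delta_k(z)=\exp\big(\sum_{j\ge1}a_jz^{-j/k}L(j)\big)(k^{1/2})^{-2L(0)}\big(z^{\frac{1}{2k}(k-1)}\big)^{-2L(0)}$.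 $T_g^k$ ($k$ even): $T_g^k(M_\sigma,Y_\sigma)=(T_g^k(M_\sigma),Y_g)=(M_\sigma,Y_g)$, where $Y_g$ is the weak $g$-twisted $V^{\otimes k}$-module structure determined by $Y_g(u^1,x)=Y_\sigma(\Delta_k(x)u,x^{1/k})$ (with $(x^{1/k})^{1/2}=x^{1/2k}$) and $Y_g(u^{j+1},x)=\lim_{x^{1/k}\to\eta^jx^{1/k}}Y_g(u^1,x)$ for $u\in V$, $j=0,\dots,k-1$. *)

(* Defs.v *)
From HB Require Import structures.
From mathcomp Require Import all_boot all_order all_algebra.
From mathcomp Require Import complex generic_quotient.
From mathcomp Require Import boolp classical_sets cardinality fsbigop reals.

Set Implicit Arguments.
Unset Strict Implicit.
Unset Printing Implicit Defensive.
Import GRing.Theory Num.Theory.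
Local Open Scope classical_set_scope.
Local Open Scope quotient_scope.
Local Open Scope ring_scope.

(* Throughout, C is the field of scalars; it is R[i] in the main statement.   *)
(* An infinite sum is a finitely supported sum [\sum_(i \in A)] (it is 0 on   *)
(* an infinite support; in all the sums below the support is finite as soon   *)
(* as the axioms of the structures involved hold).                            *)

Section LinearAlgebra.
Variable C : numClosedFieldType.

Definition subspace (M : lmodType C) (A : set M) : Prop :=
  A 0 /\ forall a u v, A u -> A v -> A (a *: u + v).

Definition linspan (M : lmodType C) (A : set M) : set M :=
  [set x | exists2 s : seq (C * M),
    (forall p, p \in s -> A p.2) & x = \sum_(p <- s) p.1 *: p.2].

Definition eigspace (M : lmodType C) (A : M -> M) (lambda : C) : set M :=
  [set w | A w = lambda *: w].

Definition decomposes (I : choiceType) (M : lmodType C) (N : I -> set M)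
    (w : M) (f : I -> M) : Prop :=
  [/\ forall i, N i (f i), finite_set [set i | f i != 0] &
      w = \sum_(i \in setT) f i].

Definition sum_space (I : choiceType) (M : lmodType C) (N : I -> set M) :
  set M := [set w | exists f, decomposes N w f].

(* M is the internal direct sum (coproduct) of the subspaces N i *)
Definition is_coprod (I : choiceType) (M : lmodType C) (N : I -> set M) :
    Prop :=
  (forall i, subspace (N i)) /\ forall w, exists! f, decomposes N w f.

(* the component of w in N i, when M is the coproduct of the N i *)
Definition component (I : choiceType) (M : lmodType C) (N : I -> set M)
    (w : M) (i : I) : M :=
  xget 0 [set x | exists2 f, decomposes N w f & x = f i].

Definition has_dim (M : lmodType C) (A : set M) (n : nat) : Prop :=
  exists b : 'I_n -> M, (forall i, A (b i)) /\
    forall v, A v -> exists! x : 'rV[C]_n, v = \sum_i x ord0 i *: b i.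

Definition finite_dim (M : lmodType C) (A : set M) : Prop :=
  exists n, has_dim A n.

Definition lindim (M : lmodType C) (A : set M) : nat := xget 0%N (has_dim A).

End LinearAlgebra.

Section TensorPower.
Variables (C : numClosedFieldType) (V : lmodType C) (k : nat).
Local Notation Vk := {ffun 'I_k -> V}.

Definition upd (v : Vk) (i : 'I_k) (x : V) : Vk :=
  [ffun j => if j == i then x else v j].

Definition multilinear (U : lmodType C) (f : Vk -> U) : Prop :=
  forall v i, linear (fun x => f (upd v i x)).

Definition feval (U : lmodType C) (f : Vk -> U) (s : seq (C * Vk)) : U :=
  \sum_(p <- s) p.1 *: f p.2.

(* The tensor power is the space of formal linear combinations of k-tuples,   *)
(* two of them being identified when all multilinear maps agree on them;      *)
(* its universal property is given by tensor_multilinear, tlift_linear,       *)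
(* tlift_tensor and tensor_span.                                              *)
Definition teq (s t : seq (C * Vk)) : bool :=
  `[< forall (U : lmodType C) (f : Vk -> U),
        multilinear f -> feval f s = feval f t >].

Lemma teq_equiv : equiv_class_of teq.
Proof.
split.
- by move=> s; apply/asboolP.
- by move=> s t; apply/asboolP/asboolP => h U f mf; rewrite h.
- move=> s t u /asboolP h1 /asboolP h2; apply/asboolP => U f mf.
  by rewrite h1 // h2.
Qed.

Canonical teq_rel := EquivRelPack teq_equiv.

Definition tpower := {eq_quot teq_rel}.

HB.instance Definition _ := Choice.on tpower.
HB.instance Definition _ := EqQuotient.on tpower.

Definition tensor (v : Vk) : tpower := \pi_tpower [:: (1, v)].

(* the linear map induced by a multilinear map f *)
Definition tlift (U : lmodType C) (f : Vk -> U) (t : tpower) : U :=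
  feval f (repr t).

Lemma tlift_pi (U : lmodType C) (f : Vk -> U) s :
  multilinear f -> tlift f (\pi_tpower s) = feval f s.
Proof.
move=> mf; have /eqmodP/asboolP h : repr (\pi_tpower s) = s %[mod tpower].
  exact: reprK.
exact: h.
Qed.

Lemma tpowerP (s t : tpower) :
  (forall (U : lmodType C) (f : Vk -> U),
    multilinear f -> tlift f s = tlift f t) -> s = t.
Proof.
move=> h; rewrite -[s]reprK -[t]reprK.
by apply/eqmodP/asboolP.
Qed.

Definition tzero : tpower := \pi_tpower [::].
Definition tscale (a : C) (s : tpower) : tpower :=
  \pi_tpower [seq (a * p.1, p.2) | p <- repr s].
Definition tadd (s t : tpower) : tpower := \pi_tpower (repr s ++ repr t).
Definition topp := tscale (-1).

Lemma tlift_zero (U : lmodType C) (f : Vk -> U) :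
  multilinear f -> tlift f tzero = 0.
Proof. by move=> mf; rewrite tlift_pi // /feval big_nil. Qed.

Lemma tlift_add (U : lmodType C) (f : Vk -> U) s t :
  multilinear f -> tlift f (tadd s t) = tlift f s + tlift f t.
Proof. by move=> mf; rewrite tlift_pi // /feval big_cat. Qed.

Lemma tlift_scale (U : lmodType C) (f : Vk -> U) a s :
  multilinear f -> tlift f (tscale a s) = a *: tlift f s.
Proof.
move=> mf; rewrite tlift_pi // /feval big_map scaler_sumr.
by apply: eq_bigr => p _; rewrite scalerA.
Qed.

Lemma taddA : associative tadd.
Proof. by move=> s t u; apply: tpowerP => U f mf; rewrite !tlift_add ?addrA. Qed.
Lemma taddC : commutative tadd.
Proof. by move=> s t; apply: tpowerP => U f mf; rewrite !tlift_add // addrC. Qed.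
Lemma tadd0 : left_id tzero tadd.
Proof.
by move=> s; apply: tpowerP => U f mf; rewrite tlift_add // tlift_zero // add0r.
Qed.
Lemma taddN : left_inverse tzero topp tadd.
Proof.
move=> s; apply: tpowerP => U f mf.
by rewrite tlift_add // tlift_scale // tlift_zero // scaleN1r addNr.
Qed.

HB.instance Definition _ :=
  GRing.isZmodule.Build tpower taddA taddC tadd0 taddN.

Lemma tscaleA a b (s : tpower) : tscale a (tscale b s) = tscale (a * b) s.
Proof. by apply: tpowerP => U f mf; rewrite !tlift_scale // scalerA. Qed.
Lemma tscale1 : left_id 1 tscale.
Proof. by move=> s; apply: tpowerP => U f mf; rewrite tlift_scale // scale1r. Qed.
Lemma tscaleDr : right_distributive tscale +%R.
Proof.
move=> a s t; apply: tpowerP => U f mf.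
by rewrite tlift_scale // !tlift_add // !tlift_scale // scalerDr.
Qed.
Lemma tscaleDl s : {morph tscale^~ s : a b / a + b}.
Proof.
move=> a b; apply: tpowerP => U f mf.
by rewrite tlift_scale // tlift_add // !tlift_scale // scalerDl.
Qed.

HB.instance Definition _ :=
  GRing.Zmodule_isLmodule.Build C tpower tscaleA tscale1 tscaleDr tscaleDl.

Lemma tlift_linear (U : lmodType C) (f : Vk -> U) :
  multilinear f -> linear (tlift f).
Proof. by move=> mf a s t; rewrite tlift_add // tlift_scale. Qed.

Lemma tlift_tensor (U : lmodType C) (f : Vk -> U) v :
  multilinear f -> tlift f (tensor v) = f v.
Proof. by move=> mf; rewrite tlift_pi // /feval big_seq1 scale1r. Qed.

Lemma tensor_multilinear : multilinear tensor.
Proof.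
move=> v i a x y; apply: tpowerP => U f mf.
by rewrite tlift_linear // !tlift_tensor // mf.
Qed.

Lemma tensor_span (t : tpower) :
  t = \sum_(p <- repr t : seq (C * Vk)) p.1 *: tensor p.2.
Proof.
apply: tpowerP => U f mf.
rewrite {1}/tlift /feval; elim: (repr t : seq _) => [|p s IHs].
  by rewrite !big_nil tlift_zero.
by rewrite !big_cons tlift_linear // tlift_tensor // IHs.
Qed.

End TensorPower.

Section FormalCalculus.
Variable C : numClosedFieldType.

(* A formal series with coefficients in M is its coefficient function: the    *)
(* exponents are rational numbers (one variable), or triples ((e0, e1), e2)   *)
(* of rational numbers for the exponents of x0, x1, x2.                       *)
Definition exp3 : Type := (rat * rat * rat)%type.

(* the formal sum over i of c i times the monomial of exponent e i *)
Definition fsum (I : choiceType) (E : Type) (M : zmodType)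
    (e : I -> E) (c : I -> M) : E -> M :=
  fun d => \sum_(i \in [set i | e i = d]) c i.

(* product of a scalar series and a vector-valued series *)
Definition fmul (E : zmodType) (M : lmodType C) (K : E -> C) (F : E -> M) :
    E -> M :=
  fun d => \sum_(e \in setT) K e *: F (d - e).

Definition fderiv (M : lmodType C) (F : rat -> M) : rat -> M :=
  fun e => ratr (e + 1) *: F (e + 1).

(* F(x^(1/k)) *)
Definition froot (k : nat) (M : zmodType) (F : rat -> M) : rat -> M :=
  fun e => F (k%:R * e).

(* the limit of F as x^(1/k) tends to z x^(1/k), for F a series in x^(1/k) *)
Definition froot_lim (k : nat) (z : C) (M : lmodType C) (F : rat -> M) :
    rat -> M :=
  fsum (fun n : int => n%:~R / k%:R) (fun n => z ^ n *: F (n%:~R / k%:R)).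

Definition gbin (s : rat) (i : nat) : C :=
  ratr ((\prod_(j < i) (s - j%:R)) / i`!%:R).

(* x0^-1 delta ((x1 - x2) / x0) *)
Definition delta12 : exp3 -> C :=
  fsum (fun p : int * nat => (- p.1%:~R - 1, p.1%:~R - p.2%:R, p.2%:R))
       (fun p => (-1) ^+ p.2 * gbin p.1%:~R p.2).

(* x0^-1 delta ((x2 - x1) / - x0) *)
Definition delta21 : exp3 -> C :=
  fsum (fun p : int * nat => (- p.1%:~R - 1, p.2%:R, p.1%:~R - p.2%:R))
       (fun p => (-1) ^ (- p.1) * ((-1) ^+ p.2 * gbin p.1%:~R p.2)).

(* x2^-1 delta (z (x1 - x0)^(1/k) / x2^(1/k)) *)
Definition delta10 (k : nat) (z : C) : exp3 -> C :=
  fsum (fun p : int * nat => (p.2%:R, p.1%:~R / k%:R - p.2%:R,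
                              - 1 - p.1%:~R / k%:R))
       (fun p => z ^ p.1 * ((-1) ^+ p.2 * gbin (p.1%:~R / k%:R) p.2)).

(* Y(v, x) w, where Y v n is the mode of v of index n / k *)
Definition vop (k : nat) (A : Type) (M : zmodType) (Y : A -> int -> M -> M)
    (v : A) (w : M) : rat -> M :=
  fsum (fun n : int => - (n%:~R / k%:R) - 1) (fun n => Y v n w).

(* Y(u, x1) Y(v, x2) w *)
Definition vop12 (k : nat) (A : Type) (M : zmodType) (Y : A -> int -> M -> M)
    (u v : A) (w : M) : exp3 -> M :=
  fun e => if e.1.1 == 0 then vop k Y u (vop k Y v w e.2) e.1.2 else 0.

(* Y(v, x2) Y(u, x1) w *)
Definition vop21 (k : nat) (A : Type) (M : zmodType) (Y : A -> int -> M -> M)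
    (u v : A) (w : M) : exp3 -> M :=
  fun e => if e.1.1 == 0 then vop k Y v (vop k Y u w e.1.2) e.2 else 0.

(* Y(YA(u, x0) v, x2) w, where YA has integral modes *)
Definition vop_iter (k : nat) (A M : zmodType) (YA : A -> int -> A -> A)
    (Y : A -> int -> M -> M) (u v : A) (w : M) : exp3 -> M :=
  fun e => if e.1.2 == 0 then vop k Y (vop 1 YA u v e.1.1) w e.2 else 0.

(* left-hand side of the Jacobi identity for u, v of signs i, j, applied to w *)
Definition jacobi_lhs (k : nat) (A : Type) (M : lmodType C)
    (Y : A -> int -> M -> M) (i j : bool) (u v : A) (w : M) : exp3 -> M :=
  fun e => fmul delta12 (vop12 k Y u v w) e
           - (-1) ^+ (i && j) *: fmul delta21 (vop21 k Y u v w) e.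

End FormalCalculus.

Section VertexOperatorSuperalgebras.
Variable C : numClosedFieldType.

(* spar j is the subspace of vectors of sign j *)
Record superspace := Superspace {
  scar :> lmodType C;
  spar : bool -> set scar
}.

Definition hcomp (S : superspace) (j : bool) (v : S) : S :=
  component (@spar S) v j.

(* vY v n is the mode v_n *)
Record vosa_data := VosaData {
  vspace :> superspace;
  vY : vspace -> int -> vspace -> vspace;
  vac : vspace;
  conf : vspace
}.

Record is_vertex_superalgebra (V : vosa_data) : Prop := {
  vsa_graded : is_coprod (@spar V);
  vsa_linearl : forall n w, linear (fun v => vY v n w : V);
  vsa_linearr : forall v n, linear (vY v n : V -> V);
  vsa_sign : forall i j (v w : V) n,
    spar i v -> spar j w -> spar (i (+) j) (vY v n w);
  vsa_vac_even : spar false (vac V);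
  vsa_trunc : forall u v : V, exists N : int, forall n, N <= n -> vY u n v = 0;
  vsa_vac : forall (w : V) e, vop 1 (@vY V) (vac V) w e = if e == 0 then w else 0;
  vsa_creation : forall v : V,
    (forall n : nat, vY v n%:Z (vac V) = 0) /\ vY v (-1) (vac V) = v;
  vsa_jacobi : forall i j (u v w : V), spar i u -> spar j v ->
    jacobi_lhs 1 (@vY V) i j u v w
    = fmul (delta10 1 1) (vop_iter 1 (@vY V) (@vY V) u v w)
}.

(* Y(omega, x) is the sum of the L(n) x^(-n-2) *)
Definition vL (V : vosa_data) (n : int) : V -> V := vY (conf V) (n + 1).

(* the space of vectors of weight n / 2 *)
Definition vwt (V : vosa_data) (n : int) : set V :=
  eigspace (vL 0) (n%:~R / 2%:R).

Record is_vosa (c : C) (V : vosa_data) : Prop := {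
  vosa_vsa : is_vertex_superalgebra V;
  vosa_conf : vwt 4 (conf V);
  vosa_virasoro : forall (m n : int) (w : V),
    vL m (vL n w) - vL n (vL m w)
    = (m - n)%:~R *: vL (m + n) w
      + (if m + n == 0 then ((m ^+ 3 - m)%:~R / 12%:R * c) *: w else 0);
  vosa_deriv : forall v w : V,
    vop 1 (@vY V) (vL (-1) v) w = fderiv (vop 1 (@vY V) v w);
  vosa_graded : is_coprod (@vwt V);
  vosa_findim : forall n, finite_dim (@vwt V n);
  vosa_lower : exists N : int, forall n, n <= N -> vwt n `<=` [set (0 : V)];
  vosa_sign : forall j : bool,
    @spar V j = sum_space (fun n : int => @vwt V (2 * n + j%:Z))
}.

Definition parity_map (V : superspace) (v : V) : V :=
  hcomp false v - hcomp true v.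

(* Y v n is the mode of v of index n / k; g stands for an automorphism of     *)
(* period k and eta for a primitive k-th root of unity                        *)
Record is_weak_twisted (V : vosa_data) (g : V -> V) (k : nat) (eta : C)
    (M : superspace) (Y : V -> int -> M -> M) : Prop := {
  tw_graded : is_coprod (@spar M);
  tw_linearl : forall n w, linear (fun v => Y v n w : M);
  tw_linearr : forall v n, linear (Y v n : M -> M);
  tw_sign : forall i j v w n,
    spar i v -> spar j w -> spar (i (+) j) (Y v n w);
  tw_trunc : forall v w, exists N : int, forall n, N <= n -> Y v n w = 0;
  tw_vac : forall w e, vop k Y (vac V) w e = if e == 0 then w else 0;
  tw_jacobi : forall i j u v w, spar i u -> spar j v ->
    jacobi_lhs k Y i j u v w
    = fun e => k%:R^-1 *:
        \sum_(l < k) fmul (delta10 k (eta ^+ l))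
                          (vop_iter k (@vY V) Y (iter l g u) v w) e
}.

(* the coefficient of x^-2 in Y(omega, x) *)
Definition twL0 (V : vosa_data) (k : nat) (M : superspace)
    (Y : V -> int -> M -> M) (w : M) : M := vop k Y (conf V) w (- 2%:R).

Record is_ordinary_twisted (V : vosa_data) (g : V -> V) (k : nat) (eta : C)
    (M : superspace) (Y : V -> int -> M -> M) : Prop := {
  ord_weak : is_weak_twisted g k eta Y;
  ord_graded : is_coprod (eigspace (twL0 k Y));
  ord_findim : forall lambda, finite_dim (eigspace (twL0 k Y) lambda);
  ord_lower : forall lambda, exists N : int, forall n : int, n <= N ->
    eigspace (twL0 k Y) (n%:~R / (2 * k)%:R + lambda) `<=` [set 0]
}.

(* A formal sum of powers q^mu, mu in C, is its coefficient function. *)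
Definition qseries := C -> nat.

(* tr_M q^A, for A diagonalizable (M is the coproduct of its eigenspaces) *)
Definition qtrace (M : lmodType C) (A : M -> M) : qseries :=
  fun mu => lindim (eigspace A mu).

(* q^s f(q) *)
Definition qshift (s : C) (f : qseries) : qseries := fun mu => f (mu - s).

(* f(q^(1/k)) *)
Definition qroot (k : nat) (f : qseries) : qseries := fun mu => f (k%:R * mu).

(* graded dimension of a twisted module for an algebra of central charge c *)
Definition graded_dim (V : vosa_data) (c : C) (k : nat) (M : superspace)
    (Y : V -> int -> M -> M) : qseries :=
  qtrace (fun w => - (c / 24%:R) *: w + twL0 k Y w).

End VertexOperatorSuperalgebras.
Arguments parity_map {C} V.

Section TensorPowerVosa.
Variables (C : numClosedFieldType) (V : vosa_data C) (k : nat).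
Local Notation Vk := {ffun 'I_k -> V}.

Definition tpar (b : bool) : set (tpower V k) :=
  linspan [set t | exists (s : 'I_k -> bool) (v : Vk),
    [/\ forall i, spar (s i) (v i), odd (\sum_(i < k) s i) = b &
        t = tensor v]].

(* The mode of index n of v_1 (x) ... (x) v_k: the signs are those of the     *)
(* homogeneous components, of signs s i for u i and r i for v i; u_j passes   *)
(* v_i for i < j.                                                             *)
Definition tmode (u : Vk) (n : int) (v : Vk) : tpower V k :=
  \sum_(s : {ffun 'I_k -> bool}) \sum_(r : {ffun 'I_k -> bool})
    (-1) ^+ (\sum_(i < k) \sum_(j < k | (i < j)%N) r i * s j)%N *:
    \sum_(m \in [set m : {ffun 'I_k -> int} |
                 \sum_(i < k) (- m i - 1) = - n - 1])
      tensor [ffun i => vY (hcomp (s i) (u i)) (m i) (hcomp (r i) (v i))].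

Definition tY (u : tpower V k) (n : int) (v : tpower V k) : tpower V k :=
  tlift (fun u0 => tlift (tmode u0 n) v) u.

(* v in the tensor factor of index j (counted from 0), vac in the others *)
Definition tfactor (j : nat) (v : V) : tpower V k :=
  tensor [ffun i : 'I_k => if val i == j then v else vac V].

Definition tpower_vosa : vosa_data C :=
  @VosaData C (Superspace tpar) tY (tensor [ffun => vac V])
    (\sum_(j < k) tfactor j (conf V)).

(* g = (1 2 ... k), i.e. v_1 (x) ... (x) v_k |-> v_2 (x) ... (x) v_k (x) v_1 *)
(* with the sign given by v_1 passing v_2, ..., v_k                           *)
Definition cyc : tpower_vosa -> tpower_vosa :=
  tlift (fun v : Vk => \sum_(s : {ffun 'I_k -> bool})
    (-1) ^+ (\sum_(i < k | val i == 0%N) \sum_(j < k | val j != 0%N)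
               s i * s j)%N *:
    tensor [ffun i => hcomp (s (ordS i)) (v (ordS i))]).

End TensorPowerVosa.
Arguments cyc {C} V k.

Section Delta.
Variable C : numClosedFieldType.

(* the derivation sum_(j >= 1) a_j x^(j+1) d/dx of C[[x]] *)
Definition vfield (a : nat -> C) (f : nat -> C) : nat -> C :=
  fun m => \sum_(1 <= j < m.+1) a j * (m - j)%:R * f (m - j)%N.

(* exp (- sum_(j >= 1) a_j x^(j+1) d/dx) f; the derivation raises the order,  *)
(* so its powers n > m do not contribute to the coefficient of x^m            *)
Definition exp_vfield (a : nat -> C) (f : nat -> C) : nat -> C :=
  fun m => \sum_(n < m.+1) (-1) ^+ n / n`!%:R * iter n (vfield a) f m.

Definition is_delta_coef (k : nat) (a : nat -> C) : Prop :=
  forall m, exp_vfield a (fun i => (i == 1)%:R) m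
    = (k%:R^-1 *: (1 + 'X) ^+ k - (k%:R^-1)%:P)`_m.

(* coefficient of t^p in (sum_(j >= 1) t^j A j)^n *)
Fixpoint opow (M : lmodType C) (A : nat -> M -> M) (n p : nat) (v : M) : M :=
  if n is n'.+1 then \sum_(1 <= j < p.+1) A j (opow A n' (p - j) v)
  else if p == 0%N then v else 0.

(* coefficient of t^p in exp (sum_(j >= 1) t^j A j); opow A n p = 0 if n > p *)
Definition oexp (M : lmodType C) (A : nat -> M -> M) (p : nat) (v : M) : M :=
  \sum_(n < p.+1) n`!%:R^-1 *: opow A n p v.

(* Delta_k(z) u as a series in z: the component of u of weight n / 2 is       *)
(* multiplied by (k^(1/2))^-n and z^(-n(k-1)/2k), and exp is expanded in      *)
(* powers of z^(-1/k).                                                        *)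
Definition Delta (V : vosa_data C) (k : nat) (a : nat -> C) (u : V) :
    rat -> V :=
  fsum (fun p : int * nat =>
          - (p.2%:R / k%:R) - p.1%:~R * ((k%:R - 1) / (2 * k)%:R))
       (fun p => oexp (fun j v => a j *: vL j%:Z v) p.2
          (2.-root k%:R ^ (- p.1) *: component (@vwt C V) u p.1)).

(* Yg is the weak g-twisted structure on T_g^k(M, Ys); here u^(j+1) is        *)
(* [tfactor k j u] and the sum is Ys(Delta_k(x) u, x^(1/k)) w                 *)
Record is_Tgk (V : vosa_data C) (k : nat) (eta : C) (a : nat -> C)
    (M : superspace C) (Ys : V -> int -> M -> M)
    (Yg : tpower_vosa V k -> int -> M -> M) : Prop := {
  Tgk_weak : is_weak_twisted (cyc V k) k eta Yg;
  Tgk_first : forall u w,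
    vop k Yg (tfactor k 0 u) w
    = fun e => \sum_(d \in setT) froot k (vop 2 Ys (Delta k a u d) w) (e - d);
  Tgk_other : forall (j : 'I_k) u w,
    vop k Yg (tfactor k j u) w
    = froot_lim k (eta ^+ j) (vop k Yg (tfactor k 0 u) w)
}.

End Delta.

(* Main.v *)
Require Import Defs.
From mathcomp Require Import all_boot all_order all_algebra.
From mathcomp Require Import complex reals.
From mathcomp Require Import boolp classical_sets cardinality fsbigop.
From mathcomp Require Import ring zify.
Import GRing.Theory Num.Theory.
Local Open Scope ring_scope.
Local Open Scope classical_set_scope.
Set Implicit Arguments.
Unset Strict Implicit.

(** The structure Y_g lives on the same space as Y_sigma, so everything
    reduces to one operator identity on M,
      L^g(0) = 1/k L^sigma(0) + (k^2 - 1) c / 24k,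
    which is [twL0_Tgk].  The eigenspaces of L^g(0) are then those of
    L^sigma(0) relabelled by an affine bijection of C ([eigspace_affine]), and
    the direct sum decomposition, the finiteness of the dimensions, the lower
    truncation ([ordinary_Tgk]) and the graded dimensions are all transported
    along this relabelling; that Y_g is a weak twisted module is part of its
    construction.  In the graded dimension the constant (k^2 - 1) c / 24k turns
    the shift - kc/24 into - c/24k, which is what q -> q^(1/k) makes of - c/24.

    For the operator identity, L^g(0) is the sum over j of the coefficients of
    x^-2 in Y_g(omega^j, x).  Moving x^(1/k) to eta^j x^(1/k) does not affect
    integral powers of x ([froot_lim_fixed]), so the k summands are equal and
    only Delta_k(x) omega matters.  Since omega = L(-2) 1, the Virasoro
    relations give L(2) omega = c/2 1 and L(j) omega = 0 for the other j > 0
    ([vL_conf]), while L(j) 1 = 0 for j > 0.  Hence only two terms of the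
    exponential survive ([Delta_conf]):
      Delta_k(x) omega = k^-2 (x^(-2(k-1)/k) omega + a_2 c/2 x^-2 1).
    Inserted in Y_sigma(-, x^(1/k)), the first contributes k^-2 L^sigma(0) to
    the coefficient of x^-2 and the second the scalar k^-2 a_2 c/2.  It remains
    to see that a_2 = (k^2 - 1)/12, which is read off from the coefficients of
    x^2 and x^3 in the equation that defines the a_j ([delta_coef2]). *)

(** * Linear maps, formal sums and direct sums *)

Lemma lin0 (C : numClosedFieldType) (U W : lmodType C) (f : U -> W) :
  linear f -> f 0 = 0.
Proof. by move=> hf; have := hf (-1) 0 0; rewrite !scaleN1r oppr0 add0r addNr. Qed.

Lemma linZ (C : numClosedFieldType) (U W : lmodType C) (f : U -> W) b x :
  linear f -> f (b *: x) = b *: f x.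
Proof. by move=> hf; have := hf b x 0; rewrite addr0 (lin0 hf) addr0. Qed.

Lemma lin_sum (C : numClosedFieldType) (U W : lmodType C) (f : U -> W)
    (I : Type) (r : seq I) (F : I -> U) :
  linear f -> f (\sum_(i <- r) F i) = \sum_(i <- r) f (F i).
Proof.
move=> hf; elim: r => [|i r IH]; first by rewrite !big_nil lin0.
by rewrite !big_cons -{1}[F i]scale1r hf scale1r IH.
Qed.

(** Most of the formal sums below have at most one nonzero term at a given
    exponent; this evaluates them without a finiteness discussion. *)
Lemma fsum_single (I : choiceType) (E : Type) (W : zmodType)
    (e : I -> E) (F : I -> W) (d : E) (i : I) :
  e i = d -> (forall j, e j = d -> j != i -> F j = 0) -> fsum e F d = F i.
Proof.
move=> ei h; transitivity (\sum_(j \in [set i]) F j); last exact: fsbig_set1.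
apply/esym/fsbig_widen.
  by move=> j ->.
by move=> j [ej /eqP ji]; apply: h.
Qed.

Lemma fsum0 (I : choiceType) (E : Type) (W : zmodType)
    (e : I -> E) (F : I -> W) (d : E) :
  (forall i, e i = d -> F i = 0) -> fsum e F d = 0.
Proof. by move=> h; apply: fsbig1. Qed.

Lemma vop_at (k : nat) (A : Type) (W : zmodType) (Y : A -> int -> W -> W)
    v w (n : int) (e : rat) :
  (0 < k)%N -> e = - (n%:~R / k%:R) - 1 -> vop k Y v w e = Y v n w.
Proof.
move=> k0 ->; apply: fsum_single => // m em /eqP; case; apply/intr_inj.
have k1 : k%:R != 0 :> rat by rewrite pnatr_eq0 -lt0n.
by apply: (mulIf (invr_neq0 k1)); apply: oppr_inj; apply: addIr em.
Qed.

Lemma component_eq (C : numClosedFieldType) (I : choiceType) (W : lmodType C)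
    (N : I -> set W) (w : W) (n i : I) :
  is_coprod N -> N n w -> component N w i = if i == n then w else 0.
Proof.
move=> [sub ex] Nw; pose f j := if j == n then w else 0.
have df : decomposes N w f.
  split.
  - by move=> j; rewrite /f; case: eqP => [->|_] //; case: (sub j).
  - apply: (@sub_finite_set _ _ [set n]); last exact: finite_set1.
    by move=> j /=; rewrite /f; case: (j =P n) => // _; rewrite eqxx.
  - rewrite -(fsbig_widen [set n]) ?fsbig_set1 /f ?eqxx //.
    by move=> j [_ /eqP /negbTE /=] ->.
have [f' [_ uf]] := ex w.
rewrite /component; apply: xget_unique; first by exists f.
by move=> y [g dg ->]; rewrite -(uf _ dg) (uf _ df).
Qed.

(** Relabelling the summands does not change a direct sum; applied to the affine
    bijection between the eigenvalues of the two grading operators. *)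
Lemma is_coprod_reindex (C : numClosedFieldType) (I J : choiceType)
    (W : lmodType C) (N : I -> set W) (h : J -> I) :
  bijective h -> is_coprod N -> is_coprod (N \o h).
Proof.
move=> bh [sub ex]; split=> [j|w]; first exact: sub.
have [h' hK h'K] := bh.
have bh' : bijective h' by exists h.
have [f [[Nf ff wf] uf]] := ex w.
exists (f \o h); split.
  split => [j|| ]; first exact: Nf.
    apply: sub_finite_set (finite_image h' ff) => j /= fj.
    by exists (h j); rewrite ?hK.
  by rewrite wf (reindex_fsbigT h).
move=> g [Ng fg wg].
have -> : f = g \o h'.
  apply: uf; split.
  - by move=> i; have := Ng (h' i); rewrite /= h'K.
  - apply: sub_finite_set (finite_image h fg) => i /= gi.
    by exists (h' i); rewrite ?h'K.
  - by rewrite wg (reindex_fsbigT h').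
by apply/funext => j /=; rewrite hK.
Qed.


Lemma eigspace_affine (C : numClosedFieldType) (W : lmodType C)
    (A B : W -> W) (s t mu : C) :
  s != 0 -> (forall w, A w = s *: B w + t *: w) ->
  eigspace A mu = eigspace B ((mu - t) / s).
Proof.
move=> s0 AB; apply/funext => w; apply/propext; rewrite /eigspace /= AB.
split=> [h|->]; last by rewrite scalerA mulrC divfK // -scalerDl subrK.
apply: (scalerI s0); rewrite scalerA [s * _]mulrC divfK // scalerBl -h.
by rewrite addrK.
Qed.

Lemma eigspace_shift (C : numClosedFieldType) (W : lmodType C)
    (B : W -> W) (s mu : C) :
  eigspace (fun w => - s *: w + B w) mu = eigspace B (mu + s).
Proof.
have e w : - s *: w + B w = 1 *: B w + - s *: w by rewrite scale1r addrC.
by rewrite (eigspace_affine mu (oner_neq0 _) e) opprK divr1.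
Qed.

(** * The coefficient a_2 of Delta_k *)

Lemma coef_binomial (R : comNzRingType) (k m : nat) :
  ((1 + 'X) ^+ k : {poly R})`_m = 'C(k, m)%:R.
Proof.
rewrite addrC exprD1n coef_sum.
case: (leqP m k) => mk.
  have mk' : (m < k.+1)%N by [].
  rewrite (bigD1 (Ordinal mk')) //= coefMn coefXn eqxx big1 ?addr0 // => i.
  by rewrite -val_eqE /= coefMn coefXn eq_sym => /negbTE ->; rewrite mul0rn.
rewrite bin_small // big1 // => i _; rewrite coefMn coefXn.
by rewrite gtn_eqF ?mul0rn // (leq_trans (ltn_ord i)).
Qed.


(** The coefficients of x^2 and x^3 of the defining equation are
    - a_1 = (k-1)/2 and - a_2 + a_1^2 = (k-1)(k-2)/6; the second order term of
    the exponential contributes a_1^2. *)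
Lemma delta_coef2 (C : numClosedFieldType) (k : nat) (a : nat -> C) :
  (0 < k)%N -> is_delta_coef k a -> a 2%N = (k%:R ^+ 2 - 1) / 12%:R.
Proof.
case: k => // k _ ha.
have k0 : k.+1%:R != 0 :> C by rewrite pnatr_eq0.
have n0 (n : nat) : n.+1%:R != 0 :> C by rewrite pnatr_eq0.
have b2 : k.+1%:R^-1 * 'C(k.+1, 2)%:R = k%:R / 2%:R :> C.
  have := congr1 (fun n => n%:R : C) (mul_bin_diag k.+1 1).
  rewrite /= bin1 !natrM => e.
  by apply: (mulfI (n0 1%N)); rewrite mulrCA -e mulKf // mulrC divfK.
have b3 : k.+1%:R^-1 * 'C(k.+1, 3)%:R = (k%:R ^+ 2 - k%:R) / 6%:R :> C.
  have e1 := congr1 (fun n => n%:R : C) (mul_bin_diag k.+1 2).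
  have e2 : ('C(k, 2) * 2 + k = k * k)%N.
    rewrite mulnC -mul_bin_diag bin1; case: (k) => // n /=.
    by rewrite [RHS]mulnS addnC.
  have {}e2 := congr1 (fun n => n%:R : C) e2.
  rewrite /= !natrM in e1; rewrite natrD !natrM in e2.
  apply: (mulfI (n0 2%N)); rewrite mulrCA -e1 mulKf //.
  by rewrite expr2 -e2; field.
have h1 := ha 2%N; have h2 := ha 3%N.
move: h1 h2.
rewrite !coefB !coefZ !coefC /= !subr0 !coef_binomial b2 b3.
rewrite /exp_vfield !big_ord_recl !big_ord0 /= /vfield.
rewrite !unlock /= => h1 h2.
have {h1} a1 : a 1%N = - (k%:R / 2%:R).
  by rewrite -h1 -[bump 0 0]/1%N -[bump 0 1]/2%N !subSS !subn0 fact0 -[1`!]/1%N -[2`!]/2%N !(mulr0, addr0, add0r, mulr1); field.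
have {h2} a2 : - a 2%N + a 1%N ^+ 2 = (k%:R ^+ 2 - k%:R) / 6%:R.
  by rewrite -h2 -[bump 0 0]/1%N -[bump 0 1]/2%N -[bump 0 2]/3%N !subSS !subn0 fact0 -[1`!]/1%N -[2`!]/2%N -[3`!]/6%N !(mulr0, addr0, add0r, mulr1); field.
by rewrite -[LHS]opprK -[- a 2%N](addrK (a 1%N ^+ 2)) a2 a1 -natr1; field.
Qed.

(** * The action of Delta_k on the conformal vector *)

Section ConformalVector.
Variables (C : numClosedFieldType) (c : C) (V : vosa_data C).
Hypothesis hV : is_vosa c V.

Let vsa := vosa_vsa hV.

Lemma vL_linear n : linear (@vL C V n).
Proof. exact: vsa_linearr vsa _ _. Qed.

Lemma vL_vac (n : nat) : vL (n%:Z - 1) (vac V) = 0.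
Proof. by rewrite /vL subrK (proj1 (vsa_creation vsa _)). Qed.

Lemma conf_vL : conf V = vL (-2) (vac V).
Proof. by rewrite /vL (proj2 (vsa_creation vsa _)). Qed.

(** L(j) omega = L(j) L(-2) 1 is the commutator [L(j), L(-2)] 1 because
    L(j) kills 1, and its first part (j + 2) L(j - 2) 1 vanishes too: only
    the central term, present for j = 2, remains. *)
Lemma vL_conf (j : nat) : (0 < j)%N ->
  vL j%:Z (conf V) = if j == 2%N then (c / 2%:R) *: vac V else 0.
Proof.
move=> j0; rewrite conf_vL.
have := vosa_virasoro hV j%:Z (-2) (vac V).
have -> : vL j (vac V) = 0 by have := vL_vac j.+1; rewrite -addn1 PoszD addrK.
have -> : vL (j%:Z + (-2)) (vac V) = 0.
  by case: j j0 => // j _; rewrite -(vL_vac j) -addn1 PoszD -addrA.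
rewrite (lin0 (vL_linear _)) subr0 scaler0 add0r => ->.
rewrite subr_eq0 -[2]/(2%:Z) eqz_nat; case: eqP => // ->.
by congr (_ *: _); rewrite /=; field.
Qed.

Variable a : nat -> C.
Let A j (v : V) := a j *: vL j%:Z v.

(** One application of the exponent sends omega to a multiple of 1, in degree 2,
    and a second one sends 1 to 0. *)
Lemma opow_conf n p (s : C) :
  opow A n p (s *: conf V) =
  if (n == 0%N) && (p == 0%N) then s *: conf V else
  if (n == 1%N) && (p == 2%N) then (s * a 2%N * (c / 2%:R)) *: vac V else 0.
Proof.
have A0 j : A j 0 = 0 by rewrite /A (lin0 (vL_linear _)) scaler0.
elim: n p => [|n IH] p /=; first by [].
transitivity (\sum_(1 <= j < p.+1) if (n == 0%N) && (p == 2%N) && (j == 2%N)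
   then (s * a 2%N * (c / 2%:R)) *: vac V else 0).
  apply: eq_big_nat => j /andP[j1 jp]; rewrite IH.
  case: (n =P 0%N) => [-> /=|_ /=].
    rewrite subn_eq0.
    case: leqP => pj; last first.
      rewrite A0; case: (j =P 2%N) pj => [->|_] pj; last by rewrite andbF.
      by rewrite gtn_eqF.
    have -> : p = j by apply/eqP; rewrite eqn_leq pj -ltnS.
    rewrite andbb /A (linZ _ _ (vL_linear _)) vL_conf //.
    by case: eqP => [->|_]; rewrite ?scaler0 ?scaler0 // !scalerA [a 2%N * s]mulrC.
  case: ifP => _; last exact: A0.
  rewrite /A (linZ _ _ (vL_linear _)).
  have -> : vL j (vac V) = 0 by have := vL_vac j.+1; rewrite -addn1 PoszD addrK.
  by rewrite !scaler0.
rewrite eqSS; case: ifP => [/andP[_ /eqP ->]|_].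
  by rewrite !unlock /= add0r addr0.
by rewrite big1.
Qed.

Lemma oexp_conf p (s : C) :
  oexp A p (s *: conf V) =
  if p == 0%N then s *: conf V else
  if p == 2%N then (s * a 2%N * (c / 2%:R)) *: vac V else 0.
Proof.
rewrite /oexp; under eq_bigr => n _ do rewrite opow_conf.
case: p => [|p].
  by rewrite big_ord1 /= fact0 invr1 scale1r.
rewrite !big_ord_recl /= scaler0 add0r /bump /= invr1 scale1r.
by rewrite big1 ?addr0 // => n _; rewrite scaler0.
Qed.

(** Of the exponents - p/k - 4(k-1)/2k of Delta_k(x) omega, those of p = 0 and
    p = 2 carry a nonzero coefficient; for p = 2 the exponent is - 2. *)
Lemma Delta_conf k d : (0 < k)%N ->
  Delta k a (conf V) d =
  if d == - (2%:R * (k%:R - 1) / k%:R) then k%:R^-2 *: conf V else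
  if d == - 2%:R then (k%:R^-2 * a 2%N * (c / 2%:R)) *: vac V else 0.
Proof.
move=> k0.
have k1 : k%:R != 0 :> rat by rewrite pnatr_eq0 -lt0n.
(* omega has weight 4/2, so (k^(1/2))^(-2 L(0)) acts on it by (k^(1/2))^-4 *)
have r4 : 2.-root k%:R ^ (-4) = k%:R^-2 :> C.
  by rewrite -[in RHS](@rootCK _ 2 _ k%:R) // -!exprM -exprnN.
have term (n : int) p :
    oexp A p (2.-root k%:R ^ (- n) *: component (@vwt C V) (conf V) n) =
    if n == 4 then
      if p == 0%N then k%:R^-2 *: conf V else
      if p == 2%N then (k%:R^-2 * a 2%N * (c / 2%:R)) *: vac V else 0
    else 0.
  rewrite (component_eq _ (vosa_graded hV) (vosa_conf hV)).
  case: eqP => [->|_]; first by rewrite r4 oexp_conf.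
  rewrite scaler0 -[X in oexp A p X](scale0r (conf V)) oexp_conf.
  by rewrite !mul0r !scale0r !if_same.
have expE (p : nat) :
    - (p%:R / k%:R) - 4%:~R * ((k%:R - 1) / (2 * k)%:R)
    = - (2%:R * (k%:R - 1) / k%:R) - p%:R / k%:R :> rat.
  by rewrite natrM; field.
have exp2 : - (2%:R * (k%:R - 1) / k%:R) - 2%:R / k%:R = - 2%:R :> rat by field.
have neq : - 2%:R != - (2%:R * (k%:R - 1) / k%:R) :> rat.
  by rewrite -exp2 -subr_eq0 addrAC subrr add0r oppr_eq0 mulf_neq0 ?invr_eq0.
case: eqP => [->|d0].
  rewrite [LHS](fsum_single (i := (4, 0%N))) /= ?term //.
    by rewrite expE mul0r subr0.
  case=> n p /= + np; rewrite term; case: (n =P 4) np => [-> np|//].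
  case: (p =P 0%N) np => [-> /eqP //|_ _]; case: (p =P 2%N) => [->|//].
  by rewrite expE exp2 => e; rewrite e eqxx in neq.
case: eqP => [->|d2].
  rewrite [LHS](fsum_single (i := (4, 2%N))) /= ?term //.
    by rewrite expE exp2.
  case=> n p /= + np; rewrite term; case: (n =P 4) np => [-> np|//].
  case: (p =P 0%N) np => [-> _|_].
    by rewrite expE mul0r subr0 => e; rewrite e eqxx in neq.
  by case: (p =P 2%N) => [-> /eqP|].
apply: fsum0 => -[n p] /=; rewrite term; case: (n =P 4) => [->|//].
case: (p =P 0%N) => [->|_]; first by rewrite expE mul0r subr0 => /esym.
by case: (p =P 2%N) => [->|//]; rewrite expE exp2 => /esym.
Qed.

End ConformalVector.

(** * Comparison of the two grading operators *)

Lemma twL0E (C : numClosedFieldType) (V : vosa_data C) (k : nat)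
    (M : superspace C) (Y : V -> int -> M -> M) (w : M) :
  (0 < k)%N -> twL0 k Y w = Y (conf V) k%:Z w.
Proof.
move=> k0; apply: vop_at => //.
by rewrite divff ?pnatr_eq0 -?lt0n // -opprD.
Qed.

(** x^m is the power km of x^(1/k), which gets multiplied by z^(km) = 1. *)
Lemma froot_lim_fixed (C : numClosedFieldType) (k : nat) (z : C)
    (W : lmodType C) (F : rat -> W) (m : int) :
  (0 < k)%N -> z ^+ k = 1 -> froot_lim k z F m%:~R = F m%:~R.
Proof.
move=> k0 zk; have k1 : k%:R != 0 :> rat by rewrite pnatr_eq0 -lt0n.
have e : (k%:Z * m)%:~R / k%:R = m%:~R :> rat.
  by rewrite intrM mulrAC divff // mul1r.
rewrite [LHS](fsum_single (i := k%:Z * m)) // ?e ?exprz_exp.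
  by rewrite -exprz_exp -exprnP zk exp1rz scale1r.
move=> j ej /eqP[]; apply/intr_inj.
by apply: (mulIf (invr_neq0 k1)); rewrite [LHS]ej e.
Qed.

(** Each of the k factors contributes the same vector S, the coefficient of
    x^-2 in Y_sigma(Delta_k(x) omega, x^(1/k)) w. *)
Lemma twL0_Tgk (C : numClosedFieldType) (V : vosa_data C) (c : C)
    (hV : is_vosa c V) (k : nat) (k0 : (0 < k)%N) (eta : C)
    (heta : k.-primitive_root eta) (a : nat -> C) (ha : is_delta_coef k a)
    (M : superspace C) (Ys : V -> int -> M -> M)
    (hM : is_weak_twisted (parity_map V) 2 (-1) Ys)
    (Yg : tpower_vosa V k -> int -> M -> M) (hT : is_Tgk eta a Ys Yg) (w : M) :
  twL0 k Yg w = k%:R^-1 *: twL0 2 Ys w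
                + ((k%:R ^+ 2 - 1) * c / (24%:R * k%:R)) *: w.
Proof.
have kQ : k%:R != 0 :> rat by rewrite pnatr_eq0 -lt0n.
have kC : k%:R != 0 :> C by rewrite pnatr_eq0 -lt0n.
have Ysl n := tw_linearl hM n w.
pose S := \sum_(d \in setT) Defs.froot k (vop 2 Ys (Delta k a (conf V) d) w) (- 2%:R - d).
have factor (j : 'I_k) : Yg (tfactor k j (conf V)) k w = S.
  (* the exponent - 2 belongs to the mode of index k / k = 1 *)
  have e2 : - 2%:R = - (k%:~R / k%:R) - 1 :> rat by rewrite divff // -opprD.
  rewrite -(vop_at Yg _ _ k0 e2) (Tgk_other hT) -[- 2%:R]/((-2)%:~R).
  rewrite froot_lim_fixed //.
    by rewrite (Tgk_first hT).
  by rewrite -exprM mulnC exprM (prim_expr_order heta) expr1n.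
rewrite twL0E // [conf _]/= (lin_sum _ _ (tw_linearl (Tgk_weak hT) _ _)).
rewrite (eq_bigr (fun=> S)) => [|j _]; last exact: factor.
rewrite sumr_const card_ord -scaler_nat.
have YsZ b u n : Ys (b *: u) n w = b *: Ys u n w by apply: (linZ b u (Ysl n)).
have Ys0 n : Ys 0 n w = 0 by apply: (lin0 (Ysl n)).
have Ysvac : Ys (vac V) (-2) w = w.
  by rewrite -(@vop_at 2 _ _ Ys _ _ (-2) 0) // (tw_vac hM) eqxx.
pose al : rat := - (2%:R * (k%:R - 1) / k%:R).
have alN : - 2%:R != al.
  rewrite -subr_eq0 [X in X != 0](_ : _ = - (2%:R / k%:R)); last by rewrite /al; field.
  by rewrite oppr_eq0 mulf_neq0 ?invr_eq0.
have -> : S = k%:R^-2 *: twL0 2 Ys w + (k%:R^-2 * a 2%N * (c / 2%:R)) *: w.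
  transitivity (\sum_(d \in [set al] `|` [set - 2%:R])
      Defs.froot k (vop 2 Ys (Delta k a (conf V) d) w) (- 2%:R - d)).
    apply/esym/fsbig_widen => // d [_ /= /not_orP[/eqP d1 /eqP d2]].
    rewrite /Defs.froot (Delta_conf hV _ _ k0) (negbTE d1) (negbTE d2).
    by apply: fsum0 => n _; exact: Ys0.
  rewrite fsbigU; [|exact: finite_set1|exact: finite_set1|]; last first.
    by move=> d /= [-> e]; rewrite e eqxx in alN.
  rewrite !fsbig_set1 /Defs.froot !(Delta_conf hV _ _ k0) eqxx (negbTE alN) eqxx.
  rewrite (@vop_at 2 _ _ Ys _ _ 2) ?(@vop_at 2 _ _ Ys _ _ (-2)) ?YsZ ?Ysvac ?twL0E //.
  - by rewrite subrr mulr0.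
  - by rewrite /al; field.
rewrite scalerDr !scalerA (delta_coef2 k0 ha).
by congr (_ *: _ + _ *: _); field.
Qed.

(** The two lower truncation conditions use different step sizes: a step 1/2k of
    L^g(0) is a step 1/2 of L^sigma(0), whereas the condition for sigma, of
    period 2, uses steps of 1/4.  From g to sigma, the even and the odd multiples
    of 1/4 are therefore treated as two progressions of step 1/2, starting at mu
    and at mu + 1/4. *)
Lemma ordinary_Tgk (C : numClosedFieldType) (V : vosa_data C) (k : nat)
    (k0 : (0 < k)%N) (eta t : C)
    (M : superspace C) (Ys : V -> int -> M -> M)
    (hM : is_weak_twisted (parity_map V) 2 (-1) Ys)
    (Yg : tpower_vosa V k -> int -> M -> M)
    (hg : is_weak_twisted (cyc V k) k eta Yg) :
  (forall w, twL0 k Yg w = k%:R^-1 *: twL0 2 Ys w + t *: w) ->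
  is_ordinary_twisted (parity_map V) 2 (-1) Ys <->
  is_ordinary_twisted (cyc V k) k eta Yg.
Proof.
move=> L; have kC : k%:R != 0 :> C by rewrite pnatr_eq0 -lt0n.
pose h (mu : C) := (mu - t) * k%:R; pose h' (mu : C) := mu / k%:R + t.
have hK : cancel h h' by move=> mu; rewrite /h /h' mulfK // subrK.
have h'K : cancel h' h by move=> mu; rewrite /h /h' addrK divfK.
have eg mu : eigspace (twL0 k Yg) mu = eigspace (twL0 2 Ys) (h mu).
  by rewrite (eigspace_affine _ _ L) ?invr_eq0 // invrK.
have es mu : eigspace (twL0 2 Ys) mu = eigspace (twL0 k Yg) (h' mu).
  by rewrite eg h'K.
split=> -[_ gr fd low]; split=> //.
- have -> : eigspace (twL0 k Yg) = eigspace (twL0 2 Ys) \o h by apply/funext.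
  by apply: is_coprod_reindex gr; exists h'.
- by move=> mu; rewrite eg.
- move=> mu; have [N hN] := low (h mu); exists (- `|N|) => n nN.
  have := hN (2 * n); rewrite eg.
  have -> : (2 * n)%:~R / (2 * 2)%:R + h mu = h (n%:~R / (2 * k)%:R + mu).
    by rewrite /h intrM !natrM; field.
  by apply; lia.
- have -> : eigspace (twL0 2 Ys) = eigspace (twL0 k Yg) \o h' by apply/funext.
  by apply: is_coprod_reindex gr; exists h.
- by move=> mu; rewrite es.
move=> mu; have [N0 hN0] := low (h' mu); have [N1 hN1] := low (h' (mu + 4%:R^-1)).
(* with n = 2m or n = 2m + 1, this bound forces m to be below N0 and N1 *)
exists (- (2 * (`|N0| + `|N1|))) => n nN.
have n2 : n = (n %/ 2)%Z * 2 + (n %% 2)%Z by exact: divz_eq.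
have [m0|m1] : (n %% 2)%Z = 0 \/ (n %% 2)%Z = 1 by lia.
- have := hN0 (n %/ 2)%Z; rewrite es.
  have -> : (n %/ 2)%Z%:~R / (2 * k)%:R + h' mu = h' (n%:~R / (2 * 2)%:R + mu).
    by rewrite [in RHS]n2 m0 /h' intrD intrM !natrM; field.
  by apply; lia.
- have := hN1 (n %/ 2)%Z; rewrite es.
  have -> : (n %/ 2)%Z%:~R / (2 * k)%:R + h' (mu + 4%:R^-1)
            = h' (n%:~R / (2 * 2)%:R + mu).
    by rewrite [in RHS]n2 m1 /h' intrD intrM !natrM; field.
  by apply; lia.
Qed.

(** * The equivalence *)

Theorem corollary6p5 (R : realType) (V : vosa_data R[i]) (c : R[i])
    (hV : is_vosa c V) (k : nat) (hk0 : (0 < k)%N) (hk : ~~ odd k)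
    (eta : R[i]) (heta : k.-primitive_root eta)
    (a : nat -> R[i]) (ha : is_delta_coef k a)
    (M : superspace R[i]) (Ys : V -> int -> M -> M)
    (hM : is_weak_twisted (parity_map V) 2 (-1) Ys)
    (Yg : tpower_vosa V k -> int -> M -> M) (hT : is_Tgk eta a Ys Yg) :
  (is_ordinary_twisted (parity_map V) 2 (-1) Ys
   /\ graded_dim c 2 Ys
      = qtrace (fun w : M => - (c / 24%:R) *: w + twL0 2 Ys w)
   /\ qtrace (fun w : M => - (c / 24%:R) *: w + twL0 2 Ys w)
      = qshift (- (c / 24%:R))
          (fun lambda => lindim (eigspace (twL0 2 Ys) lambda)))
  <->
  (is_ordinary_twisted (cyc V k) k eta Yg
   /\ graded_dim (k%:R * c) k Yg
      = qtrace (fun w : M => - (k%:R * c / 24%:R) *: w + twL0 k Yg w)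
   /\ qtrace (fun w : M => - (k%:R * c / 24%:R) *: w + twL0 k Yg w)
      = qtrace (fun w : M =>
          - (k%:R * c / 24%:R) *: w + k%:R^-1 *: twL0 2 Ys w
          + ((k%:R ^+ 2 - 1) * c / (24%:R * k%:R)) *: w)
   /\ qtrace (fun w : M =>
          - (k%:R * c / 24%:R) *: w + k%:R^-1 *: twL0 2 Ys w
          + ((k%:R ^+ 2 - 1) * c / (24%:R * k%:R)) *: w)
      = qroot k (graded_dim c 2 Ys)).

Proof.
have L := twL0_Tgk hV hk0 heta ha hM hT.
have ord := ordinary_Tgk hk0 hM (Tgk_weak hT) L.
have kC : k%:R != 0 :> R[i] by rewrite pnatr_eq0 -lt0n.
split=> -[o _]; split; try by apply/ord.
- split; first by [].
  split.
    by congr qtrace; apply/funext => w; rewrite L addrA.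
  apply/funext => mu; rewrite /qroot /graded_dim /qtrace eigspace_shift.
  congr lindim.
  have e w : - (k%:R * c / 24%:R) *: w + k%:R^-1 *: twL0 2 Ys w
          + ((k%:R ^+ 2 - 1) * c / (24%:R * k%:R)) *: w = k%:R^-1 *: twL0 2 Ys w
          + (- (k%:R * c / 24%:R) + (k%:R ^+ 2 - 1) * c / (24%:R * k%:R)) *: w.
    by rewrite scalerDl addrCA addrA.
  rewrite (eigspace_affine _ _ e) ?invr_eq0 //.
  by congr eigspace; field; exact: kC.
- split; first by [].
  by apply/funext => mu; rewrite /qtrace /qshift eigspace_shift opprK.
Qed.
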